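(* Let $\ell\in\overline{\mathbb N}_0$ be such that $\ell\ge 1$. Let $\sigma\in C^{\infty}[0,1]$ be such that: (i) $\sigma(x)+\sigma(1-x)=1$ for $0\le x\le 1$; (ii) $\sigma^{(k)}(0)=0$ for $k=0,\dots,\ell$; (iii) $\sigma'(x)>0$ for $0<x<1$. Then $\sigma$ is a smooth step function of order $\ell$.
   Context: $\overline{\mathbb N}_0=\{0,1,2,\dots\}\cup\{\infty\}$. When an order equals $\infty$, the corresponding conditions are understood to hold for every finite derivative order. $C^\infty[0,1]$ denotes real-valued infinitely differentiable functions on $[0,1]$ (one-sided derivatives at endpoints). A smooth step function of order $\ell$ is a strictly increasing function $\sigma:[0,1]\to[0,1]$, $\sigma\in C^\infty[0,1]$, with $\sigma(0)=0$, $\sigma(1)=1$, and $\sigma^{(j)}(0)=\sigma^{(j)}(1)=0$ for $j=1,\dots,\ell$. *)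

(* Defs.v *)
From HB Require Import structures.
From mathcomp Require Import all_boot all_order all_algebra.
From mathcomp Require Import all_classical all_reals all_analysis.

Set Implicit Arguments.
Unset Strict Implicit.
Unset Printing Implicit Defensive.

Import Order.TTheory GRing.Theory Num.Theory.
Import numFieldNormedType.Exports.

Local Open Scope classical_set_scope.
Local Open Scope ring_scope.

(* [Infinity] as an order stands for "every finite derivative order". *)
Variant enat : Type := Finite of nat | Infinity.

Definition le_enat (k : nat) (l : enat) : bool :=
  if l is Finite n then (k <= n)%N else true.

(* A function on [0, 1] is encoded as a function R -> R of which only the
   values on [0, 1] are used. Difference quotients therefore have both points
   in [0, 1]: the derivative is two-sided inside and one-sided at 0 and 1.
   [derive1] of the library would use points outside of [0, 1]. *)
Definition slope01 (R : realType) (f : R -> R) (x : R) : R -> R :=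
  fun y => (f y - f x) / (y - x).

(* Meaningful only where the limit exists. *)
Definition derive01 (R : realType) (f : R -> R) : R -> R :=
  fun x => lim (slope01 f x @ within `[0, 1] x^').

Definition derivable01 (R : realType) (f : R -> R) : Prop :=
  forall x : R, x \in `[0, 1] -> cvg (slope01 f x @ within `[0, 1] x^').

Definition derive01n (R : realType) (k : nat) (f : R -> R) : R -> R :=
  iter k (@derive01 R) f.

Definition smooth01 (R : realType) (f : R -> R) : Prop :=
  forall k : nat, derivable01 (derive01n k f).

Record smooth_step (R : realType) (l : enat) (f : R -> R) : Prop := SmoothStep {
  smooth_step_smooth : smooth01 f;
  smooth_step_range : forall x : R, x \in `[0, 1] -> f x \in `[0, 1];
  smooth_step_incr : {in `[0, 1] &, {homo f : x y / x < y}};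
  smooth_step0 : f 0 = 0;
  smooth_step1 : f 1 = 1;
  smooth_step_flat : forall j : nat, (1 <= j)%N -> le_enat j l ->
    derive01n j f 0 = 0 /\ derive01n j f 1 = 0
}.

(* Main.v *)
Require Import Defs.
From HB Require Import structures.
From mathcomp Require Import all_boot all_order all_algebra.
From mathcomp Require Import all_classical all_reals all_analysis.
From mathcomp Require Import ring lra.

(** Differentiating the symmetry [sigma x + sigma (1 - x) = 1] gives
    [sigma^(k) x = (-1)^(k-1) sigma^(k) (1 - x)] for every [k >= 1]
    ([derive01n_reflect]), so flatness at 0 transfers to flatness at 1, and
    the symmetry itself gives [sigma 1 = 1 - sigma 0 = 1].  A function that
    is differentiable on [0, 1] is continuous there, so the positive
    derivative inside makes [sigma] strictly increasing by the mean value
    theorem ([derive01_gt0_lt]), and hence its values lie between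
    [sigma 0 = 0] and [sigma 1 = 1].

    What needs work is the passage between limits along the punctured
    neighbourhoods relative to [0, 1] and the two-sided limits of the
    usual derivative, which are only sure to agree at interior points. *)

Set Implicit Arguments.
Unset Strict Implicit.
Unset Printing Implicit Defensive.

Import Order.TTheory GRing.Theory Num.Theory.
Import numFieldNormedType.Exports.

Local Open Scope classical_set_scope.
Local Open Scope ring_scope.

(** Every point of [0, 1] can be approached inside [0, 1], from the right or
    from the left; limits there are therefore unique. *)
Lemma dnbhs01_proper (R : realType) (x : R) :
  x \in `[0, 1] -> ProperFilter (within `[0, 1] x^').
Proof.
rewrite in_itv/= => /andP[x0 x1].
apply: Build_ProperFilter_ex => P; rewrite /within/dnbhs/within/= => xP.
have [xlt1|xge1] := ltP x 1.
- apply: (@filter_ex _ x^'+).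
  near=> y.
  have xy : x < y by near: y; exact: nbhs_right_gt.
  have y1 : y < 1 by near: y; exact: nbhs_right_lt.
  have : y != x -> y \in `[0, 1] -> P y by near: y; apply: cvg_within; exact: xP.
  apply; first by rewrite gt_eqF.
  by rewrite in_itv/=; lra.
- apply: (@filter_ex _ x^'-).
  near=> y.
  have xy : y < x by near: y; exact: nbhs_left_lt.
  have y0 : 0 < y by near: y; apply: nbhs_left_gt; lra.
  have : y != x -> y \in `[0, 1] -> P y by near: y; apply: cvg_within; exact: xP.
  apply; first by rewrite lt_eqF.
  by rewrite in_itv/=; lra.
Unshelve. all: by end_near. Qed.

Lemma cvg_reflect01 (R : realType) (x : R) :
  (1 - y) @[y --> within `[0, 1] x^'] --> within `[0, 1] (1 - x)^'.
Proof.
have cx : (1 - y) @[y --> x] --> 1 - x.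
  by apply: cvgB; [exact: cvg_cst | exact: cvg_id].
move=> P /cx xP; apply: (@filterS _ (nbhs x)) xP => y /= yP yx y01; apply: yP.
- by apply: contra_neq yx; lra.
- by move: y01; rewrite !in_itv/=; lra.
Qed.

Lemma cvg_derive01 (R : realType) (f : R -> R) (x : R) :
  derivable01 f -> x \in `[0, 1] ->
  slope01 f x @ within `[0, 1] x^' --> derive01 f x.
Proof. by move=> df /df. Qed.

Lemma derive01_eq (R : realType) (f : R -> R) (x l : R) :
  x \in `[0, 1] -> slope01 f x @ within `[0, 1] x^' --> l -> derive01 f x = l.
Proof. by move=> /dnbhs01_proper ? /cvg_lim; apply. Qed.

(** The reflection [y |-> 1 - y] carries difference quotients of [f] at
    [1 - x] to those at [x], up to the factor [- s]. *)
Lemma derive01_reflect (R : realType) (f : R -> R) (c s : R) :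
  derivable01 f ->
  (forall x : R, x \in `[0, 1] -> f x = c + s * f (1 - x)) ->
  forall x : R, x \in `[0, 1] -> derive01 f x = - s * derive01 f (1 - x).
Proof.
move=> df fE x x01; apply: derive01_eq => //.
have x'01 : 1 - x \in `[0, 1] by move: x01; rewrite !in_itv/=; lra.
have : - s * slope01 f (1 - x) (1 - y) @[y --> within `[0, 1] x^'] -->
    - s * derive01 f (1 - x).
  apply: cvgMl_tmp.
  exact: (cvg_comp _ _ (@cvg_reflect01 _ x) (cvg_derive01 df x'01)).
apply: cvg_trans; apply: near_eq_cvg; near=> y.
have y01 : y \in `[0, 1] by near: y; exact: withinT.
have yx : y != x by near: y; apply: cvg_within; exact: withinT.
rewrite /= /slope01 (fE x x01) (fE y y01).
have -> : 1 - y - (1 - x) = - (y - x) by ring.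
by rewrite invrN; ring.
Unshelve. all: by end_near. Qed.

(** The additive constant of the symmetry disappears at the first
    derivative, and each further derivative contributes one sign. *)
Lemma derive01n_reflect (R : realType) (f : R -> R) (c : R) :
  smooth01 f ->
  (forall x : R, x \in `[0, 1] -> f x + f (1 - x) = c) ->
  forall k (x : R), x \in `[0, 1] ->
  derive01n k.+1 f x = (-1) ^+ k * derive01n k.+1 f (1 - x).
Proof.
move=> smf symf; elim=> [|k IHk] x x01.
  have -> : (-1) ^+ 0 = - (-1) :> R by rewrite opprK.
  apply: (@derive01_reflect _ f c) => //; first exact: (smf 0%N).
  by move=> y /symf <-; ring.
rewrite exprS mulN1r; apply: (@derive01_reflect _ _ 0) => //.
  exact: (smf k.+1).
by move=> y /IHk; rewrite add0r.
Qed.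

Lemma derivable01_continuous (R : realType) (f : R -> R) :
  derivable01 f -> {within `[0, 1], continuous f}.
Proof.
move=> df; apply/subspace_continuousP => x x01.
(* [f y] is rebuilt from the difference quotient; at [y = x], which the
   punctured filter misses, [f y] is already equal to the limit. *)
have fx : f y @[y --> within `[0, 1] x^'] --> f x.
  have yx0 : (y - x) @[y --> within `[0, 1] x^'] --> x - x.
    apply: cvgB; last exact: cvg_cst.
    by apply: cvg_within_filter; apply: cvg_within_filter; exact: cvg_id.
  have : slope01 f x y * (y - x) + f x @[y --> within `[0, 1] x^'] -->
      derive01 f x * (x - x) + f x.
    by apply: cvgD (cvg_cst _); exact: cvgM (cvg_derive01 df x01) yx0.
  rewrite subrr mulr0 add0r; apply: cvg_trans; apply: near_eq_cvg; near=> y.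
  have yx : y != x by near: y; apply: cvg_within; exact: withinT.
  by rewrite /= /slope01 divfK ?subr_eq0// subrK.
move=> P Pfx; apply: (@filterS _ (nbhs x)) (fx P Pfx) => y /= yP y01.
by have [->|/yP] := eqVneq y x; [exact: nbhs_singleton | exact].
Unshelve. all: by end_near. Qed.

(** At an interior point, [0, 1] is a neighbourhood, and the derivative
    relative to [0, 1] is the two-sided one. *)
Lemma is_derive01 (R : realType) (f : R -> R) (x : R) :
  derivable01 f -> x \in `]0, 1[ -> is_derive x 1 f (derive01 f x).
Proof.
move=> df x01.
have xcc : x \in `[0, 1] by move: x01; rewrite !in_itv/=; lra.
suff fx : h^-1 *: ((f \o shift x) (h *: 1) - f x) @[h --> 0^'] -->
    derive01 f x.
  by apply: DeriveDef; [apply/cvg_ex; exists (derive01 f x) | exact/cvg_lim].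
have hx : (h + x) @[h --> 0^'] --> within `[0, 1] x^'.
  have cx : (h + x) @[h --> (0 : R)] --> x.
    rewrite -[X in _ --> X]add0r.
    by apply: cvgD; [exact: cvg_id | exact: cvg_cst].
  move=> P /cx xP.
  apply: (@filterS2 _ (nbhs (0 : R))) xP (cx _ (near_in_itvoo x01)).
  move=> h /= xP hx h0; apply: xP.
  - by rewrite -subr_eq0 addrK.
  - by move: hx; rewrite !in_itv/=; lra.
have := cvg_comp _ _ hx (cvg_derive01 df xcc).
apply: cvg_trans; apply: near_eq_cvg; near=> h.
by rewrite /= /slope01 addrK mulrC /GRing.scale/= mulr1.
Unshelve. all: by end_near. Qed.

Lemma derive01_gt0_lt (R : realType) (f : R -> R) :
  derivable01 f -> (forall x : R, x \in `]0, 1[ -> 0 < derive01 f x) ->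
  {in `[0, 1] &, {homo f : x y / x < y}}.
Proof.
move=> df f'0; apply: gtr0_derive1_lt_cc.
- by move=> x /(is_derive01 df) [].
- move=> x x01; rewrite derive1E.
  by rewrite (@derive_val _ _ _ _ _ _ _ (is_derive01 df x01)) f'0.
- exact: derivable01_continuous.
Qed.

Theorem corollary3 (R : realType) (l : enat) (hl : le_enat 1 l)
    (sigma : R -> R) (sigma_smooth : smooth01 sigma)
    (sigma_sym : forall x : R, 0 <= x <= 1 -> sigma x + sigma (1 - x) = 1)
    (sigma_flat0 : forall k : nat, le_enat k l -> derive01n k sigma 0 = 0)
    (sigma_deriv_gt0 : forall x : R, 0 < x < 1 -> 0 < derive01n 1 sigma x) :
  smooth_step l sigma.
Proof.
have s0 : sigma 0 = 0 by apply: (sigma_flat0 0%N); case: (l).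
have s1 : sigma 1 = 1.
  have := sigma_sym 0; rewrite s0 add0r subr0; apply.
  by rewrite lexx ler01.
have incr : {in `[0, 1] &, {homo sigma : x y / x < y}}.
  apply: derive01_gt0_lt; first exact: (sigma_smooth 0%N).
  by move=> x; rewrite in_itv/=; exact: sigma_deriv_gt0.
have i0 : (0 : R) \in `[0, 1] by rewrite in_itv/= lexx ler01.
have i1 : (1 : R) \in `[0, 1] by rewrite in_itv/= lexx ler01.
split=> //.
- move=> x x01; have := x01; rewrite !in_itv/= => /andP[x0 x1].
  have mono := ltW_homo_in incr.
  by rewrite -{1}s0 -s1 !mono.
- case=> // j _ jl; split; first exact: sigma_flat0.
  have sym x : x \in `[0, 1] -> sigma x + sigma (1 - x) = 1.
    by rewrite in_itv/=; exact: sigma_sym.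
  by rewrite (derive01n_reflect sigma_smooth sym)// subrr sigma_flat0// mulr0.
Qed.
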